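(* Let $m=m(t)$ be a positive integer depending on $t$ with $t \le m(t) \le 2^{t/16}$. Then for all sufficiently large $t$, log-concavity of the independent set sequence of $T_{m,t,1}$ is broken at $mt+2$; that is, $$ \big(i_{mt+2}(T_{m,t,1})\big)^2 < i_{mt+1}(T_{m,t,1})\, i_{mt+3}(T_{m,t,1}). $$
   Context: For positive integers $m,t$, the rooted tree $T_{m,t,1}$ is defined as follows: the root $v$ has $m$ children $w_1,\dots,w_m$; each $w_i$ has $t$ children $x_i^1,\dots,x_i^t$; and each $x_i^j$ has exactly one child $y_i^j$, which is a leaf. (So $T_{m,t,1}$ has $1+m+2mt$ vertices.) For a graph $G$, an independent set is a set of vertices no two of which are adjacent, and $i_k(G)$ denotes the number of independent sets in $G$ of cardinality $k$. Log-concavity of a positive sequence $(a_k)$ is said to be broken at $k$ if $a_k^2 < a_{k-1}a_{k+1}$. *)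

(* Defs.v *)
From HB Require Import structures.
From mathcomp Require Import all_boot.

Set Implicit Arguments.
Unset Strict Implicit.
Unset Printing Implicit Defensive.

Section IndependentSets.

Variables (V : finType) (adj : rel V).

Definition independent (S : {set V}) : bool :=
  [forall u in S, forall v in S, ~~ adj u v].

(* i_k(G) for the graph G with vertex set V and adjacency relation adj *)
Definition num_indep (k : nat) : nat :=
  #|[set S : {set V} | independent S & #|S| == k]|.

End IndependentSets.

(* Vertices of T_{m,t,1}: the root v, and w_i, x_i^j, y_i^j for i < m, j < t. *)
Inductive Tvertex (m t : nat) : Type :=
  | Tv
  | Tw of 'I_m
  | Tx of 'I_m & 'I_t
  | Ty of 'I_m & 'I_t.

Arguments Tv {m t}.
Arguments Tw {m t} i.
Arguments Tx {m t} i j.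
Arguments Ty {m t} i j.

Section Tree.

Variables m t : nat.

Let code : Type := (unit + 'I_m + 'I_m * 'I_t + 'I_m * 'I_t)%type.

Definition Tvertex_encode (u : Tvertex m t) : code :=
  match u with
  | Tv => inl (inl (inl tt))
  | Tw i => inl (inl (inr i))
  | Tx i j => inl (inr (i, j))
  | Ty i j => inr (i, j)
  end.

Definition Tvertex_decode (c : code) : Tvertex m t :=
  match c with
  | inl (inl (inl _)) => Tv
  | inl (inl (inr i)) => Tw i
  | inl (inr (i, j)) => Tx i j
  | inr (i, j) => Ty i j
  end.

Lemma Tvertex_encodeK : cancel Tvertex_encode Tvertex_decode.
Proof. by case. Qed.

Lemma Tvertex_decodeK : cancel Tvertex_decode Tvertex_encode.
Proof. by case=> [[[[]|i]|[i j]]|[i j]]. Qed.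

HB.instance Definition _ := Countable.copy (Tvertex m t) (can_type Tvertex_encodeK).
HB.instance Definition _ : isFinite (Tvertex m t) := CanIsFinite Tvertex_encodeK.

(* Tchild u c: c is a child of u. *)
Definition Tchild (u c : Tvertex m t) : bool :=
  match u, c with
  | Tv, Tw _ => true
  | Tw i, Tx i' _ => i == i'
  | Tx i j, Ty i' j' => (i == i') && (j == j')
  | _, _ => false
  end.

Definition Tadj : rel (Tvertex m t) := fun u v => Tchild u v || Tchild v u.

Lemma Tadj_sym : symmetric Tadj.
Proof. by move=> u v; rewrite /Tadj orbC. Qed.

Lemma Tadj_irr : irreflexive Tadj.
Proof. by case. Qed.

Lemma card_Tvertex : #|{: Tvertex m t}| = 1 + m + 2 * (m * t).
Proof.
have bij_enc : bijective Tvertex_encode.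
  by exists Tvertex_decode; [exact: Tvertex_encodeK | exact: Tvertex_decodeK].
rewrite (bij_eq_card bij_enc) !card_sum card_unit !card_prod !card_ord.
by rewrite mul2n -addnn addnA.
Qed.

End Tree.

(* i_k(T_{m,t,1}) *)
Definition iT (m t k : nat) : nat := num_indep (@Tadj m t) k.

(* Main.v *)
(* The independence polynomial of T_{m,t,1} is
     x (1 + 2x)^{mt} + sum_k C(m,k) x^k (1 + x)^{tk} (1 + 2x)^{t(m-k)},
   and the k-th summand has degree mt + k.  Put B = 2^t.  The first term, of
   degree mt + 1, gives i_{mt+1} >= B^m and nothing beyond; the summand k = 3
   gives i_{mt+3} >= B^(m-3).  For i_{mt+2}, the summand k = r + 2 contributes
   at most m^2 (m^2 t)^r B^(m-2-r), so that i_{mt+2} <= 2 m^2 B^(m-2) as soon as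
   2 m^2 t <= B.  Hence i_{mt+2}^2 <= 4 m^4 B^(2m-4), which is less than
   B^(2m-3) because m^16 <= B. *)

Require Import Defs.
From mathcomp Require Import all_boot all_order all_algebra.
From mathcomp Require Import all_classical all_reals all_analysis.
From mathcomp Require Import zify.
(* again, so that subsetP, set0, setT, ... are not those of classical_sets *)
From mathcomp Require Import fintype finset.

Set Implicit Arguments.
Unset Strict Implicit.
Unset Printing Implicit Defensive.

Import Order.TTheory GRing.Theory Num.Theory.

(** * Elementary estimates and sums over subsets *)

Lemma bin_leq_expn n k : 'C(n, k) <= n ^ k.
Proof.
elim: k => [|k IHk]; first by rewrite bin0.
rewrite expnS; apply: leq_trans (leq_pmull _ (ltn0Sn k)) _.
by rewrite mul_bin_left leq_mul // leq_subr.
Qed.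

(** The extra [q ^ n] makes the induction close: the new last term and the new extra term add up to
    [2 * q * q ^ n <= B * q ^ n]. *)
Lemma geometric_sum_leq q B n : 2 * q <= B ->
  \sum_(r < n.+1) q ^ r * B ^ (n - r) + q ^ n <= 2 * B ^ n.
Proof.
move=> le_qB; elim: n => [|n IHn]; first by rewrite big_ord1.
rewrite big_ord_recr /= subnn muln1.
have -> : \sum_(r < n.+1) q ^ r * B ^ (n.+1 - r)
        = B * \sum_(r < n.+1) q ^ r * B ^ (n - r).
  rewrite big_distrr; apply: eq_bigr => r _ /=.
  by rewrite subSn -1?ltnS // expnS mulnCA.
rewrite -addnA addnn -mul2n expnS mulnA.
apply: leq_trans (_ : B * (2 * B ^ n) <= _); last by rewrite expnS mulnCA.
apply: leq_trans (leq_mul (leqnn B) IHn).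
by rewrite mulnDr leq_add2l leq_mul2r le_qB orbT.
Qed.

Lemma sum_set_by_card (T : finType) (h : nat -> nat) :
  \sum_(A : {set T}) h #|A| = \sum_(k < #|T|.+1) 'C(#|T|, k) * h k.
Proof.
rewrite (partition_big (fun A : {set T} => inord #|A| : 'I_#|T|.+1) xpredT) //.
apply: eq_bigr => k _.
have inordE (A : {set T}) : (inord #|A| == k) = (#|A| == k).
  by rewrite -val_eqE /= inordK // ltnS max_card.
rewrite (eq_bigl _ _ inordE) (eq_bigr (fun=> h k)); last by move=> A /eqP->.
rewrite sum_nat_const -card_draws; congr (_ * _).
by apply: eq_card => A; rewrite !inE.
Qed.

(** * Independent sets of the tree in coordinates *)

Section TreeSets.

Variables m t : nat.
Local Notation P := ('I_m * 'I_t)%type.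

Definition Tset (b : bool) (W : {set 'I_m}) (X Y : {set P}) :
    {set Tvertex m t} :=
  [set u | match u with
           | Tv => b
           | Tw i => i \in W
           | Tx i j => (i, j) \in X
           | Ty i j => (i, j) \in Y
           end].

Lemma TsetP (S : {set Tvertex m t}) : exists b W X Y, S = Tset b W X Y.
Proof.
exists (Tv \in S), [set i | Tw i \in S], [set p | Tx p.1 p.2 \in S],
  [set p | Ty p.1 p.2 \in S].
by apply/setP; case=> *; rewrite !inE.
Qed.

Lemma Tset_injX b W Y1 Y2 X1 X2 : Tset b W X1 Y1 = Tset b W X2 Y2 -> X1 = X2.
Proof.
by move/setP=> eqS; apply/setP=> -[i j]; have := eqS (Tx i j); rewrite !inE.
Qed.

Lemma card_Tset b W X Y : #|Tset b W X Y| = b + #|W| + #|X| + #|Y|.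
Proof.
rewrite -sum1_card (reindex (@Tvertex_decode m t)) /=; last first.
  by apply: onW_bij; exists (@Tvertex_encode m t);
     [exact: Tvertex_decodeK | exact: Tvertex_encodeK].
rewrite !big_sumType /= -!sum1_card.
congr (_ + _ + _ + _); try by apply: eq_bigl => -[i j]; rewrite !inE.
by rewrite big_mkcond /= (big_pred1 tt); [rewrite inE; case: b | case].
Qed.

(** One condition for each kind of edge: v to w, w to x, x to y. *)
Lemma independent_Tset (b : bool) (W : {set 'I_m}) (X Y : {set P}) :
  reflect [/\ b -> W = set0, forall i j, i \in W -> (i, j) \notin X
            & [disjoint X & Y]]
    (independent (@Tadj m t) (Tset b W X Y)).
Proof.
apply: (iffP 'forall_implyP) => [indS | [bW WX dXY] u uS].
  have {}indS u v : u \in Tset b W X Y -> v \in Tset b W X Y -> ~~ Tadj u v.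
    by move=> uS vS; have /'forall_implyP := indS u uS; apply.
  split=> [tb | i j iW | ].
  - apply/setP=> i; rewrite inE; apply/negP=> iW.
    by have := indS Tv (Tw i); rewrite !inE => /(_ tb iW).
  - apply/negP=> ijX; have := indS (Tw i) (Tx i j); rewrite !inE => /(_ iW ijX).
    by rewrite /Tadj /= eqxx.
  apply/pred0P=> -[i j] /=; apply/negP=> /andP[ijX ijY].
  have := indS (Tx i j) (Ty i j); rewrite !inE => /(_ ijX ijY).
  by rewrite /Tadj /= !eqxx.
have child v w : v \in Tset b W X Y -> w \in Tset b W X Y -> ~~ Tchild v w.
  case: v w => [|i|i j|i j] [|i'|i' j'|i' j']; rewrite !inE //=.
  - by move=> /bW ->; rewrite inE.
  - by move=> iW i'X; apply/eqP=> e; move: (WX i j' iW); rewrite e i'X.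
  - move=> ijX ijY; apply/andP=> -[/eqP e1 /eqP e2]; subst.
    by move/pred0P: dXY => /(_ (i', j')) /=; rewrite ijX ijY.
by apply/'forall_implyP=> v vS; rewrite negb_or !child.
Qed.

(** The indices of the x's that remain available once the w's in [W] are taken. *)
Definition pairs_off (W : {set 'I_m}) : {set P} := [set p | p.1 \notin W].

Lemma card_pairs_off W : #|pairs_off W| = t * (m - #|W|).
Proof.
have -> : pairs_off W = setX (~: W) setT by apply/setP=> p; rewrite !inE andbT.
rewrite cardsX cardsT card_ord mulnC; congr (_ * _).
by rewrite cardsCs setCK card_ord.
Qed.

(* Take v if b holds, take w_i for i in W, and one end of each edge x_i^j y_i^j:
   the choice of this end is free for i outside W. *)
Lemma iT_ge (b : bool) (W : {set 'I_m}) : (b -> W = set0) ->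
  2 ^ (t * (m - #|W|)) <= iT m t (m * t + (b + #|W|)).
Proof.
move=> bW; rewrite -card_pairs_off -card_powerset.
pose f (X : {set P}) := Tset b W X (~: X).
have f_inj : injective f by move=> X1 X2; apply: Tset_injX.
rewrite -(card_imset _ f_inj); apply: subset_leq_card; apply/subsetP=> S.
case/imsetP=> X; rewrite inE => /subsetP XW ->; rewrite inE; apply/andP; split.
  apply/independent_Tset; split=> // [i j iW | ]; last first.
    by rewrite -setI_eq0 setICr.
  by apply/negP=> /XW; rewrite inE iW.
rewrite card_Tset; have := cardsC X; rewrite card_prod !card_ord; lia.
Qed.

(** In [(W, (E, X))], [E] is meant as the set of avoided edges. Overlaps of [E] and [X] are allowed:
    this only overcounts, and the codes over a fixed [W] form a product. *)
Definition codes : {set {set 'I_m} * ({set P} * {set P})} :=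
  [set q : {set 'I_m} * ({set P} * {set P}) |
     (#|q.2.1| + 2 == #|q.1|) && (q.2.2 \subset pairs_off q.1)].

(* An independent set of size mt + 2 misses v and is determined by its w's, the
   edges x_i^j y_i^j that it avoids and its x's; being of size mt + 2, it avoids
   two fewer such edges than it has w's. *)
Lemma iT_leq_codes : iT m t (m * t + 2) <= #|codes|.
Proof.
pose g (q : {set 'I_m} * ({set P} * {set P})) :=
  Tset false q.1 q.2.2 (~: (q.2.2 :|: q.2.1)).
apply: leq_trans (leq_imset_card g codes); apply: subset_leq_card.
apply/subsetP=> S; rewrite inE; have [b [W [X [Y ->]]]] := TsetP S.
case/andP=> /independent_Tset[bW WX dXY]; rewrite card_Tset => /eqP cardS.
have cXY : #|X :|: Y| = #|X| + #|Y|.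
  rewrite cardsU -[RHS]subn0; congr (_ - _).
  by apply/eqP; rewrite cards_eq0 setI_eq0.
have := cardsC (X :|: Y); rewrite cXY card_prod !card_ord => cC.
(* The root would force [W] to be empty, hence a size of at most [m * t + 1]. *)
have b0 : b = false.
  by case: b bW cardS => // /(_ isT) ->; rewrite cards0; lia.
apply/imsetP; exists (W, (~: (X :|: Y), X)).
  rewrite !inE /=; apply/andP; split.
    by move: cC cardS; rewrite b0; move: #|X| #|Y| #|~: _| #|W| => x y z w; lia.
  apply/subsetP=> -[i j] ijX; rewrite inE.
  by apply/negP=> /WX - /(_ j); rewrite ijX.
rewrite /g b0 /=; congr Tset; apply/setP=> p; rewrite !inE.
move/pred0P: dXY => /(_ p) /=.
by case: (p \in X); case: (p \in Y).
Qed.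

(** The factor [2 <= k] guards the truncated [k - 2]: without it, [k < 2] would contribute through
    ['C(m * t, 0) = 1]. *)
Lemma card_codes :
  #|codes| = \sum_(k < m.+1) 'C(m, k) *
    ((2 <= k) * ('C(m * t, k - 2) * 2 ^ (t * (m - k)))).
Proof.
rewrite -[m in RHS]card_ord.
rewrite -(sum_set_by_card _ (fun k =>
  (2 <= k) * ('C(#|'I_m| * t, k - 2) * 2 ^ (t * (#|'I_m| - k))))).
rewrite !card_ord.
transitivity (\sum_(W : {set 'I_m}) #|[set r | (W, r) \in codes]|).
  under eq_bigr do rewrite -sum1_card.
  by rewrite pair_big_dep -sum1_card; apply: eq_bigl => -[W r]; rewrite !inE.
apply: eq_bigr => W _; rewrite -card_pairs_off.
have [W2|W1] := leqP 2 #|W|; last first.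
  rewrite mul0n; apply/eqP; rewrite cards_eq0; apply/eqP/setP=> -[E X].
  by rewrite !inE /=; case: eqP => // cE; rewrite -cE addn2 in W1.
rewrite mul1n -card_powerset.
have -> : 'C(m * t, #|W| - 2) = #|[set E : {set P} | #|E| == #|W| - 2]|.
  by rewrite card_draws card_prod !card_ord.
rewrite -cardsX; apply: eq_card => -[E X]; rewrite !inE /=; congr (_ && _).
by move: #|E| #|W| W2 => e w w2; lia.
Qed.

End TreeSets.

(** * Numerical comparison of the three coefficients *)

Lemma iT_leq m t : 2 <= m -> 2 * (m ^ 2 * t) <= 2 ^ t ->
  iT m t (m * t + 2) <= 2 * m ^ 2 * 2 ^ (t * (m - 2)).
Proof.
move=> m2 hB; apply: leq_trans (iT_leq_codes m t) _; rewrite card_codes.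
case: m m2 hB => [|[|n]] // _ hB.
(* The summands [k = 0] and [k = 1] vanish; with [k = r + 2], the rest is compared to a geometric
   sum with [q = m ^ 2 * t] and [B = 2 ^ t]. *)
rewrite 2!big_ord_recl /= !mul0n !muln0 !add0n.
have geo := leq_trans (leq_addr _ _) (geometric_sum_leq n hB).
rewrite 2!subSS subn0 expnM -mulnA [leqRHS]mulnCA.
apply: leq_trans (leq_mul (leqnn _) geo).
rewrite big_distrr; apply: leq_sum => -[r /= lt_rn] _.
rewrite /bump /= !add1n mul1n !subSS subn0.
rewrite expnM !mulnA leq_mul2r; apply/orP; right.
apply: leq_trans (leq_mul (bin_leq_expn _ _) (bin_leq_expn _ _)) _.
have -> // : n.+2 ^ r.+2 * (n.+2 * t) ^ r = n.+2 ^ 2 * (n.+2 ^ 2 * t) ^ r.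
rewrite (expnMn _ t) (expnMn (_ ^ 2)) -(expnM _ 2) !mulnA -!expnD.
by congr (_ ^ _ * _); lia.
Qed.

Lemma iT_log_concavity_broken m t : 3 <= t -> t <= m -> m ^ 16 <= 2 ^ t ->
  iT m t (m * t + 2) ^ 2 < iT m t (m * t + 1) * iT m t (m * t + 3).
Proof.
move=> t3 tm mB; have m3 := leq_trans t3 tm.
have m_gt0 : 0 < m by lia.
have B4 : 4 * m ^ 4 < 2 ^ t.
  apply: leq_trans mB; rewrite (@expnD m 12 4) ltn_mul2r expn_gt0 m_gt0 /=.
  apply: leq_trans (_ : m ^ 2 <= _); last by rewrite leq_pexp2l.
  by apply: leq_trans (_ : 3 ^ 2 <= _) => //; rewrite leq_exp2r.
(* By [t <= m], the left side is at most [4 * m ^ 4]. *)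
have B2 : 2 * (m ^ 2 * t) <= 2 ^ t.
  apply: leq_trans (ltnW B4); rewrite (@expnD m 2 2).
  apply: leq_trans (_ : 4 * (m ^ 2 * t) <= _); first by rewrite leq_mul.
  by rewrite !leq_mul // (leq_trans tm) // leq_pmulr.
have i1 : 2 ^ (t * m) <= iT m t (m * t + 1).
  by have := @iT_ge m t true set0 (fun=> erefl); rewrite cards0 subn0 addn0.
have i3 : 2 ^ (t * (m - 3)) <= iT m t (m * t + 3).
  pose W := [set widen_ord m3 i | i : 'I_3].
  have cW : #|W| = 3.
    by rewrite card_imset ?card_ord // => i j /(congr1 val) /= /val_inj.
  by have := @iT_ge m t false W; rewrite cW; apply.
have i2 := iT_leq (ltnW m3) B2.
apply: leq_ltn_trans (leq_mul i2 i2) _; apply: leq_trans (leq_mul i1 i3).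
(* Since [m + (m - 3) = 1 + 2 * (m - 2)], one factor [2 ^ t] is left over to beat [4 * m ^ 4]. *)
have -> : 2 ^ (t * m) * 2 ^ (t * (m - 3))
        = 2 ^ t * (2 ^ (t * (m - 2)) * 2 ^ (t * (m - 2))).
  by rewrite -!expnD -!mulnDr -mulnS; congr (_ ^ (_ * _)); clear -m3; lia.
have -> : forall c, 2 * m ^ 2 * c * (2 * m ^ 2 * c) = 4 * m ^ 4 * (c * c).
  by move=> c; rewrite (@expnD m 2 2); clear; lia.
by rewrite ltn_mul2r muln_gt0 expn_gt0.
Qed.

Theorem theorem2p1 (R : realType) (m : nat -> nat)
    (hm : exists t1 : nat, forall t : nat, t1 <= t ->
      [/\ 0 < m t, t <= m t & ((m t)%:R <= (2%:R : R) `^ (t%:R / 16%:R))%R]) :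
  exists t0 : nat, forall t : nat, t0 <= t ->
    iT (m t) t (m t * t + 2) ^ 2 <
      iT (m t) t (m t * t + 1) * iT (m t) t (m t * t + 3).
Proof.
have [t1 {}hm] := hm; exists (maxn t1 3) => t.
rewrite geq_max => /andP[/hm[_ le_tm le_m2] t3].
apply: iT_log_concavity_broken => //.
(* Raising the real bound on [m t] to the 16th power removes the fractional exponent. *)
rewrite -(@ler_nat R) !natrX.
have /le_trans -> // : ((m t)%:R ^+ 16 <= (2%:R `^ (t%:R / 16%:R)) ^+ 16 :> R)%R.
  by rewrite lerXn2r // nnegrE ?powR_ge0 ?ler0n.
by rewrite -powR_mulrn ?powR_ge0 // -powRrM divfK ?pnatr_eq0 // powR_mulrn ?ler0n.
Qed.
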